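(* Let $\varphi:\mathbb{D}\to\mathbb{D}$ be analytic. Then $$\left\|\frac{\sqrt{1-|\varphi(0)|^2}}{1-\overline{\varphi(0)}\,\varphi(z)}\right\|_\infty = \sqrt{\frac{1+|\varphi(0)|}{1-|\varphi(0)|}}$$ if and only if either $\varphi(0)=0$, or $\varphi(0)\ne 0$ and $\dfrac{\varphi(0)}{|\varphi(0)|}\in \partial(\varphi(\mathbb{D}))$.
   Context: $\mathbb{D}=\{z\in\mathbb{C}:|z|<1\}$. For an analytic function $\psi:\mathbb{D}\to\mathbb{C}$, $\|\psi\|_\infty=\sup_{z\in\mathbb{D}}|\psi(z)|$; the norm in the claim is that of the function $z\mapsto \frac{\sqrt{1-|\varphi(0)|^2}}{1-\overline{\varphi(0)}\,\varphi(z)}$ on $\mathbb{D}$. $\partial(\varphi(\mathbb{D}))$ denotes the topological boundary in $\mathbb{C}$ of the image $\varphi(\mathbb{D})$. *)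

(* Defs.v *)
From Stdlib Require Import Reals.
From Coquelicot Require Import Coquelicot.
Open Scope R_scope.

Definition unit_disc (z : C) : Prop := Cmod z < 1.

(* Functions on the disc are total functions [C -> C]; every notion below only
   looks at their values on the disc, which is open. *)
Definition analytic_on_disc (f : C -> C) : Prop :=
  forall z : C, unit_disc z ->
    ex_derive (K := C_AbsRing) (V := C_NormedModule) f z.

(* Valued in [Rbar], so that it is [p_infty] for an unbounded function. *)
Definition sup_norm (f : C -> C) : Rbar :=
  Lub_Rbar (fun r : R => exists z : C, unit_disc z /\ r = Cmod (f z)).

Definition image_disc (f : C -> C) (w : C) : Prop :=
  exists z : C, unit_disc z /\ w = f z.

Definition boundary (A : C -> Prop) (w : C) : Prop :=
  forall U : C -> Prop, open (T := C_UniformSpace) U -> U w ->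
    (exists u : C, U u /\ A u) /\ (exists u : C, U u /\ ~ A u).

(* Main.v *)
Require Import Defs.
From Stdlib Require Import Reals Lra.
From Coquelicot Require Import Coquelicot.

(** Write [a] for the value of the map at the origin, [r = |a|], and, when
    [a <> 0], [e = a / r].  For [w] in the unit disc,
      (1 - r) + (r / 2) |w - e|^2 <= |1 - conj(a) w| <= (1 - r) + r |w - e|
    ([Cmod_one_minus_lower], [Cmod_one_minus_upper]).  The left inequality
    bounds the quotient by sqrt (1 - r^2) / (1 - r) = sqrt ((1 + r) / (1 - r));
    the two together say that the denominators approach [1 - r] exactly when
    the values [w] approach [e].  Hence the bound is the supremum iff [e] is
    adherent to the image, and as [e] has modulus 1 it lies outside the image,
    so adherent means boundary.  When [a = 0] the quotient is constantly 1. *)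

(** * Suprema and boundaries *)

Lemma sup_norm_eq_iff (f : C -> C) (M : R) :
  (forall z, unit_disc z -> Cmod (f z) <= M) ->
  (sup_norm f = Finite M <->
   forall eps, 0 < eps -> exists z, unit_disc z /\ M - eps < Cmod (f z)).
Proof.
  intros HM; unfold sup_norm.
  destruct (Lub_Rbar_correct (fun r => exists z, unit_disc z /\ r = Cmod (f z)))
    as [Hub Hleast].
  split.
  - intros HE eps He.
    apply Classical_Prop.NNPP; intros Hn.
    rewrite HE in Hleast.
    assert (H : Rbar_le M (M - eps)).
    { apply Hleast; intros x [z [Hz ->]]; simpl.
      destruct (Rle_or_lt (Cmod (f z)) (M - eps)) as [h|h]; [exact h|].
      exfalso; apply Hn; exists z; auto. }
    simpl in H; lra.
  - intros H.
    apply is_lub_Rbar_unique; split.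
    + intros x [z [Hz ->]]; exact (HM z Hz).
    + intros b Hb; destruct b as [b| |]; simpl; auto.
      * destruct (Rle_or_lt M b) as [h|h]; [exact h|].
        destruct (H (M - b)) as [z [Hz Hlt]]; [lra|].
        assert (Hle := Hb _ (ex_intro _ z (conj Hz eq_refl))).
        simpl in Hle; lra.
      * destruct (H 1 Rlt_0_1) as [z [Hz _]].
        exact (Hb _ (ex_intro _ z (conj Hz eq_refl))).
Qed.

Lemma open_Cmod_ball (w : C) (eps : R) :
  open (T := C_UniformSpace) (fun u : C => Cmod (u - w) < eps).
Proof.
  intros u Hu.
  exists (mkposreal ((eps - Cmod (u - w)) / 2) ltac:(lra)).
  intros v [Hv1 Hv2].
  change (Rabs (fst v - fst u) < (eps - Cmod (u - w)) / 2) in Hv1.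
  change (Rabs (snd v - snd u) < (eps - Cmod (u - w)) / 2) in Hv2.
  assert (Hsplit : Cmod (v - w) <= Cmod (v - u) + Cmod (u - w)).
  { replace (v - w)%C with ((v - u) + (u - w))%C by ring.
    apply Cmod_triangle. }
  (* the uniform balls of the plane are squares, hence the factor sqrt 2 < 2 *)
  assert (Hsq := Cmod_2Rmax (v - u)).
  assert (H2 : sqrt 2 < 2).
  { rewrite <- (sqrt_pow2 2) at 2 by lra.
    apply sqrt_lt_1; lra. }
  assert (Hs0 := sqrt_pos 2).
  assert (Hm : Rmax (Rabs (fst (v - u)%C)) (Rabs (snd (v - u)%C))
               < (eps - Cmod (u - w)) / 2).
  { apply Rmax_lub_lt; assumption. }
  assert (H0 : 0 <= Rmax (Rabs (fst (v - u)%C)) (Rabs (snd (v - u)%C))).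
  { eapply Rle_trans; [apply Rabs_pos | apply Rmax_l]. }
  nra.
Qed.

Lemma boundary_iff_adherent (A : C -> Prop) (w : C) :
  ~ A w ->
  (boundary A w <-> forall eps, 0 < eps -> exists u, A u /\ Cmod (u - w) < eps).
Proof.
  intros Hw; split.
  - intros H eps He.
    destruct (H _ (open_Cmod_ball w eps)) as [[u [Hu HA]] _].
    + replace (w - w)%C with (RtoC 0) by ring.
      rewrite Cmod_0; exact He.
    + exists u; auto.
  - intros H U HU Uw; split; [|exists w; auto].
    destruct (HU w Uw) as [eps Heps].
    destruct (H eps (cond_pos eps)) as [u [Au Hu]].
    exists u; split; [|exact Au].
    apply Heps; split.
    + exact (Rle_lt_trans _ _ _ (Rle_trans _ _ _ (Rmax_l _ _) (Rmax_Cmod (u - w)%C)) Hu).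
    + exact (Rle_lt_trans _ _ _ (Rle_trans _ _ _ (Rmax_r _ _) (Rmax_Cmod (u - w)%C)) Hu).
Qed.

(** * The denominator near its minimum *)

Lemma Cmod_sqr (z : C) : Cmod z ^ 2 = fst z ^ 2 + snd z ^ 2.
Proof.
  unfold Cmod; rewrite pow2_sqrt; [reflexivity | nra].
Qed.

(** The triangle inequality for [1 - conj(r e) w = (1 - r) - r conj(e) (w - e)],
    which uses [conj(e) e = 1]. *)
Lemma Cmod_one_minus_upper (r : R) (e w : C) :
  0 <= r <= 1 -> Cmod e = 1 ->
  Cmod (1 - Cconj (r * e) * w) <= (1 - r) + r * Cmod (w - e).
Proof.
  intros Hr He.
  assert (Hsqr := Cmod_sqr e); rewrite He in Hsqr.
  replace (1 - Cconj (r * e) * w)%C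
    with (RtoC (1 - r) + - (RtoC r * Cconj e * (w - e)))%C.
  - eapply Rle_trans; [apply Cmod_triangle|].
    rewrite Cmod_opp, !Cmod_mult, Cmod_conj, He, !Cmod_R.
    rewrite !Rabs_pos_eq by lra; lra.
  - destruct e as [x y], w as [p q]; simpl in Hsqr.
    apply injective_projections; simpl.
    + replace (1 - r) with (1 - r * (x * (x * 1) + y * (y * 1))) by (rewrite <- Hsqr; ring).
      ring.
    + ring.
Qed.

(** With [a = r e], already the real part of [1 - conj(a) w] obeys the bound: it exceeds
    [1 - r] by [r (1 - Re (conj(e) w))], and, as [|w| <= 1 = |e|], expanding
    the square gives [|w - e|^2 <= 2 (1 - Re (conj(e) w))]. *)
Lemma Cmod_one_minus_lower (r : R) (e w : C) :
  0 <= r -> Cmod e = 1 -> Cmod w <= 1 ->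
  (1 - r) + r / 2 * Cmod (w - e) ^ 2 <= Cmod (1 - Cconj (r * e) * w).
Proof.
  intros Hr He Hw.
  assert (Hsqe := Cmod_sqr e); rewrite He in Hsqe.
  assert (Hsqw := Cmod_sqr w).
  assert (Hw2 : Cmod w ^ 2 <= 1) by (assert (h := Cmod_ge_0 w); nra).
  eapply Rle_trans; [|apply (Rle_trans _ _ _ (Rle_abs _) (Rle_trans _ _ _ (Rmax_l _ _) (Rmax_Cmod _)))].
  rewrite Cmod_sqr.
  destruct e as [x y], w as [p q]; simpl in *.
  assert (0 <= r * (1 - (p * p + q * q))) by (apply Rmult_le_pos; lra).
  assert (Hrr : r = r * (x * x + y * y)) by (replace (x * x + y * y) with 1 by lra; ring).
  lra.
Qed.

(** * The quotient *)

Lemma sqrt_quotient (r : R) :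
  0 <= r < 1 -> sqrt ((1 + r) / (1 - r)) = sqrt (1 - r ^ 2) / (1 - r).
Proof.
  intros Hr.
  replace ((1 + r) / (1 - r)) with ((1 - r ^ 2) / (1 - r) ^ 2) by (field; lra).
  rewrite sqrt_div_alt by nra.
  rewrite sqrt_pow2 by lra; reflexivity.
Qed.

(** Put [s = sqrt (1 - r^2)] and [D = |1 - conj(r e) phi(z)|].  The modulus
    [s / D] of the quotient decreases in [D], so it comes arbitrarily close to its bound
    [s / (1 - r)] exactly when [D] comes arbitrarily close to [1 - r], and the
    bounds on [D] turn this into closeness of the values to [e]. *)
Lemma sup_norm_quotient_iff (phi : C -> C) (r : R) (e : C) :
  0 < r < 1 -> Cmod e = 1 ->
  (forall z, unit_disc z -> unit_disc (phi z)) ->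
  (sup_norm (fun z => (RtoC (sqrt (1 - r ^ 2)) / (1 - Cconj (r * e) * phi z))%C)
     = Finite (sqrt ((1 + r) / (1 - r)))
   <-> boundary (image_disc phi) e).
Proof.
  intros Hr He Hphi.
  rewrite sqrt_quotient by lra.
  set (s := sqrt (1 - r ^ 2)).
  assert (Hs : 0 < s) by (apply sqrt_lt_R0; nra).
  set (D := fun z => Cmod (1 - Cconj (r * e) * phi z)).
  assert (HD : forall z, unit_disc z ->
            (1 - r) + r / 2 * Cmod (phi z - e) ^ 2 <= D z).
  { intros z Hz; apply Cmod_one_minus_lower; [lra | exact He |].
    apply Rlt_le, Hphi, Hz. }
  assert (HD1 : forall z, unit_disc z -> 1 - r <= D z).
  { intros z Hz; specialize (HD z Hz).
    assert (h := pow2_ge_0 (Cmod (phi z - e))); nra. }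
  assert (Hq : forall z, unit_disc z ->
            Cmod (RtoC s / (1 - Cconj (r * e) * phi z)) = s / D z).
  { intros z Hz; specialize (HD1 z Hz).
    rewrite Cmod_div by (apply Cmod_gt_0; change (0 < D z); lra).
    rewrite Cmod_R, Rabs_pos_eq by lra; reflexivity. }
  rewrite sup_norm_eq_iff, boundary_iff_adherent.
  - split.
    + intros H eps Heps.
      (* [d] is the excess of the denominator which forces [|w - e| < eps] *)
      set (d := r / 2 * eps ^ 2).
      assert (Hd : 0 < d).
      { apply Rmult_lt_0_compat; [lra | apply pow_lt, Heps]. }
      destruct (H (s / (1 - r) - s / (1 - r + d))) as [z [Hz Hlt]].
      { apply Rlt_0_minus, Rmult_lt_compat_l; [exact Hs|].
        apply Rinv_lt_contravar; [apply Rmult_lt_0_compat; lra | lra]. }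
      rewrite Hq in Hlt by exact Hz.
      specialize (HD z Hz); specialize (HD1 z Hz).
      assert (HDd : D z < 1 - r + d).
      { destruct (Rlt_or_le (D z) (1 - r + d)) as [h|h]; [exact h|].
        assert (s / D z <= s / (1 - r + d)); [|lra].
        apply Rmult_le_compat_l; [lra|].
        apply Rinv_le_contravar; lra. }
      exists (phi z); split; [exists z; auto|].
      unfold d in HDd.
      destruct (Rlt_or_le (Cmod (phi z - e)) eps) as [h|h]; [exact h|].
      assert (eps ^ 2 <= Cmod (phi z - e) ^ 2) by (apply pow_incr; lra).
      nra.
    + intros H eps Heps.
      (* [s/(1-r) - s/D = s (D - (1-r)) / ((1-r) D) <= s r |w - e| / (1-r)^2] *)
      destruct (H (eps * (1 - r) ^ 2 / s)) as [u [[z [Hz ->]] Hlt]].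
      { apply Rdiv_lt_0_compat; [apply Rmult_lt_0_compat; [lra | nra] | exact Hs]. }
      exists z; split; [exact Hz|].
      rewrite Hq by exact Hz.
      specialize (HD1 z Hz).
      assert (Hup : D z <= (1 - r) + r * Cmod (phi z - e))
        by (apply Cmod_one_minus_upper; [lra | exact He]).
      apply (Rmult_lt_compat_l s) in Hlt; [|exact Hs].
      replace (s * (eps * (1 - r) ^ 2 / s)) with (eps * (1 - r) ^ 2) in Hlt
        by (field; lra).
      assert (Hnum : s * (D z - (1 - r)) < eps * (1 - r) ^ 2).
      { assert (h := Cmod_ge_0 (phi z - e)).
        eapply Rle_lt_trans; [|exact Hlt].
        apply Rmult_le_compat_l; [lra | nra]. }
      assert (Hgap : s / (1 - r) - s / D z < eps); [|lra].
      replace (s / (1 - r) - s / D z)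
        with (s * (D z - (1 - r)) / ((1 - r) * D z)) by (field; lra).
      apply Rlt_div_l; [nra|].
      eapply Rlt_le_trans; [exact Hnum|].
      apply Rmult_le_compat_l; [lra | nra].
  - intros [z [Hz E]].
    specialize (Hphi z Hz); unfold unit_disc in Hphi.
    rewrite <- E, He in Hphi; lra.
  - intros z Hz; rewrite Hq by exact Hz; specialize (HD1 z Hz).
    apply Rmult_le_compat_l; [lra|].
    apply Rinv_le_contravar; lra.
Qed.

Lemma Cmod_normalize (a : C) : a <> RtoC 0 -> Cmod (a / RtoC (Cmod a)) = 1.
Proof.
  intros Ha.
  assert (Hpos := proj1 (Cmod_gt_0 a) Ha).
  rewrite Cmod_div by (intros h; injection h; lra).
  rewrite Cmod_R, Rabs_pos_eq by lra.
  field; lra.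
Qed.

Theorem theorem3p3 :
  forall phi : C -> C,
    analytic_on_disc phi ->
    (forall z : C, unit_disc z -> unit_disc (phi z)) ->
    (sup_norm (fun z : C =>
        (RtoC (sqrt (1 - Cmod (phi (RtoC 0)) ^ 2)%R)
           / (RtoC 1 - Cconj (phi (RtoC 0)) * phi z))%C)
      = Finite (sqrt ((1 + Cmod (phi (RtoC 0))) / (1 - Cmod (phi (RtoC 0))))%R)
     <->
     phi (RtoC 0) = RtoC 0 \/
     (phi (RtoC 0) <> RtoC 0 /\
      boundary (image_disc phi)
        (phi (RtoC 0) / RtoC (Cmod (phi (RtoC 0))))%C)).
Proof.
  intros phi _ Hphi.
  assert (H00 : unit_disc (RtoC 0)) by (unfold unit_disc; rewrite Cmod_0; lra).
  assert (Ha := Hphi _ H00); unfold unit_disc in Ha.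
  set (a := phi (RtoC 0)) in *.
  destruct (Ceq_dec a (RtoC 0)) as [E|E].
  - split; [intros _; left; exact E | intros _].
    rewrite E, Cmod_0.
    assert (Hone : forall z,
      Cmod (RtoC (sqrt (1 - 0 ^ 2)) / (1 - Cconj (RtoC 0) * phi z)) = 1).
    { intros z.
      replace (1 - Cconj (RtoC 0) * phi z)%C with (RtoC 1).
      - replace (1 - 0 ^ 2) with 1 by ring.
        rewrite sqrt_1, Cmod_div, Cmod_1 by (intros h; injection h; lra).
        field.
      - destruct (phi z); apply injective_projections; simpl; ring. }
    replace ((1 + 0) / (1 - 0)) with 1 by field.
    rewrite sqrt_1.
    apply sup_norm_eq_iff.
    + intros z _; rewrite Hone; lra.
    + intros eps Heps; exists (RtoC 0); split; [exact H00|].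
      rewrite Hone; lra.
  - assert (Hr : 0 < Cmod a) by (apply Cmod_gt_0; exact E).
    assert (Hpolar : (RtoC (Cmod a) * (a / RtoC (Cmod a)))%C = a).
    { field; intros h; injection h; lra. }
    assert (K := sup_norm_quotient_iff phi (Cmod a) (a / RtoC (Cmod a))
                   (conj Hr Ha) (Cmod_normalize a E) Hphi).
    rewrite Hpolar in K.
    rewrite K; tauto.
Qed.
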